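(* Let $\mathbb{K}$ be a field, let $N\geq 1$, and let $I$ be a homogeneous ideal of $R=\mathbb{K}[x_0,\ldots,x_N]$ with $(0)\neq I\subsetneq R$. Then $\widehat{\rho}(I)=\rho'(I)$.
   Context: For $m\geq 1$ the $m$-th symbolic power of $I$ is $I^{(m)}=R\cap\bigcap_{P\in \mathrm{Ass}(R/I)} I^mR_P$, where the intersections take place in the fraction field of $R$. Throughout, $m,r,t$ denote positive integers. For $t\geq 1$ set $\rho(I,t)=\sup\{\frac{m}{r} : I^{(m)}\not\subseteq I^r,\ m\geq t,\ r\geq t\}$. Then $\rho'(I)=\limsup_{t}\rho(I,t)=\lim_{t\to\infty}\rho(I,t)$. The asymptotic resurgence is $\widehat{\rho}(I)=\sup\{\frac{m}{r} : I^{(mt)}\not\subseteq I^{rt} \text{ for all } t\gg 0\}$. *)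

(* Defs.v *)
From mathcomp Require Import all_boot all_order all_algebra.
From mathcomp Require Import mpoly.
From mathcomp Require Import boolp classical_sets reals ereal.
From mathcomp Require Import topology normedtype sequences.

Set Implicit Arguments.
Unset Strict Implicit.
Unset Printing Implicit Defensive.

Import Order.TTheory GRing.Theory Num.Theory.

Local Open Scope classical_set_scope.
Local Open Scope ring_scope.

(* Ideals are Prop-valued sets. MathComp's [idealr_closed] requires 1 to lie
   outside the set, so it describes exactly the proper ideals. *)
Definition proper_idealr (A : comNzRingType) (I : set A) : Prop :=
  idealr_closed (mem I).

Definition prime_idealr (A : comNzRingType) (P : set A) : Prop :=
  proper_idealr P /\ prime_idealr_closed (mem P).

(* Finite sums of products; also used with I and J subsets of a fraction
   field, to form the extension of an ideal to a localization. *)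
Definition idealM (A : comNzRingType) (I J : set A) : set A :=
  [set x | exists (n : nat) (a b : 'I_n -> A),
     [/\ forall i, I (a i), forall i, J (b i) & x = \sum_(i < n) a i * b i]].

Definition idealX (A : comNzRingType) (I : set A) (n : nat) : set A :=
  iter n (idealM I) setT.

(* Prime ideals that are annihilators of a class f + I in A / I. *)
Definition Ass (A : comNzRingType) (I : set A) : set (set A) :=
  [set P | prime_idealr P /\ exists f : A, P = [set g | I (g * f)]].

Definition localization (A : idomainType) (P : set A) : set {fraction A} :=
  [set x | exists a s : A, ~ P s /\ x = tofrac a / tofrac s].

Definition symbolic_power (A : idomainType) (I : set A) (m : nat) : set A :=
  [set f | forall P, Ass I P ->
     idealM (@tofrac A @` idealX I m) (localization P) (tofrac f)].

(* Suprema are taken in the extended reals. *)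
Definition rho (R : realType) (A : idomainType) (I : set A) (t : nat) : \bar R :=
  ereal_sup [set x | exists m r : nat,
    [/\ (0 < m)%N /\ (0 < r)%N, (t <= m)%N, (t <= r)%N,
        ~ (symbolic_power I m `<=` idealX I r)
      & x = (m%:R / r%:R)%:E]].

Definition rho_lim (R : realType) (A : idomainType) (I : set A) : \bar R :=
  limn_esup (rho R I).

Definition asymptotic_resurgence (R : realType) (A : idomainType) (I : set A) :
    \bar R :=
  ereal_sup [set x | exists m r : nat,
    [/\ (0 < m)%N, (0 < r)%N,
        \forall t \near \oo,
          ~ (symbolic_power I (m * t) `<=` idealX I (r * t))
      & x = (m%:R / r%:R)%:E]].

(* [pihomog mdeg d p] is the homogeneous component of degree d of p. *)
Definition homogeneous_ideal (K : fieldType) (n : nat)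
    (I : set {mpoly K[n]}) : Prop :=
  forall (p : {mpoly K[n]}) (d : nat), I p -> I (pihomog mdeg d p).

(* Main.v *)
(* The asymptotic resurgence is bounded by rho(I, t) for every t, because m / r
   = (m u) / (r u). Conversely, let I be generated by s elements, and suppose
   I^(m0 T) is contained in I^{r0 T} for arbitrarily large T. If
   m0 (r + s) < r0 m and f is in I^(m), then f^k is in I^(k m), which lies in
   I^(m0 T) and hence in I^{k (r + s)} for k about m0 T / m and T large; the
   Briancon-Skoda theorem then gives f in I^r. So m / r > m0 / r0 + eps forces
   I^(m) to lie in I^r as soon as r is large, whence rho'(I) <= m0 / r0.
   The Briancon-Skoda theorem needed here (f^k in I^{k (N + s)} implies f in
   I^N) is proved over an algebraically closed field of characteristic p with
   the Frobenius: f^k f^q lies in the q-th Frobenius power of I^N for all q =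
   p^e, and for large q coefficient extraction removes f^k. The general case is
   reduced to it by specializing the finitely many coefficients involved. *)

Require Import Defs.
From mathcomp Require Import all_boot all_order all_algebra.
From mathcomp Require Import closed_field lra.
From mathcomp Require Import mpoly.
From mathcomp Require Import boolp classical_sets reals ereal.
From mathcomp Require Import topology normedtype sequences.

Set Implicit Arguments.
Unset Strict Implicit.
Unset Printing Implicit Defensive.

Import Order.TTheory GRing.Theory Num.Theory.

Local Open Scope classical_set_scope.
Local Open Scope ring_scope.

(** * Ideals and their powers *)

(** Unlike [proper_idealr], this admits the unit ideal, so that [idealX I 0] qualifies. *)
Definition ideal (A : comNzRingType) (J : set A) : Prop :=
  J 0 /\ forall a x y, J x -> J y -> J (a * x + y).

Lemma ideal0 (A : comNzRingType) (J : set A) : ideal J -> J 0.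
Proof. by case. Qed.

Lemma idealMl (A : comNzRingType) (J : set A) a x : ideal J -> J x -> J (a * x).
Proof. by case=> J0 Jl Jx; rewrite -[_ * _]addr0; apply: Jl. Qed.

Lemma idealD (A : comNzRingType) (J : set A) x y :
  ideal J -> J x -> J y -> J (x + y).
Proof. by case=> J0 Jl Jx Jy; rewrite -[x]mul1r; apply: Jl. Qed.

Lemma idealB (A : comNzRingType) (J : set A) x y :
  ideal J -> J x -> J y -> J (x - y).
Proof.
by move=> idJ Jx Jy; rewrite -mulN1r; apply: idealD => //; apply: idealMl.
Qed.

Lemma ideal_sum (A : comNzRingType) (J : set A) (T : Type) (r : seq T)
    (P : pred T) (F : T -> A) :
  ideal J -> (forall i, P i -> J (F i)) -> J (\sum_(i <- r | P i) F i).
Proof.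
by move=> idJ JF; apply: big_ind => // [|x y]; [apply: ideal0|apply: idealD].
Qed.

Lemma proper_ideal (A : comNzRingType) (I : set A) : proper_idealr I -> ideal I.
Proof.
case=> I0 _ Il; split; first by move: I0; rewrite inE.
by move=> a x y Ix Iy; have := Il a x y; rewrite !inE; apply.
Qed.

Lemma idealM_unit (A : comNzRingType) (I J : set A) a b :
  I a -> J b -> idealM I J (a * b).
Proof.
move=> Ia Jb; exists 1%N, (fun=> a), (fun=> b); split=> //.
by rewrite big_ord1.
Qed.

Lemma idealM0 (A : comNzRingType) (I J : set A) : idealM I J 0.
Proof.
exists 0%N, (fun=> 0), (fun=> 0); split; rewrite ?big_ord0 //; by case.
Qed.

Lemma idealM_add (A : comNzRingType) (I J : set A) x y :
  idealM I J x -> idealM I J y -> idealM I J (x + y).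
Proof.
move=> [n [a [b [Ia Jb ->]]]] [m [c [d [Ic Jd ->]]]].
exists (n + m)%N, (fun i => match split i with inl j => a j | inr j => c j end),
  (fun i => match split i with inl j => b j | inr j => d j end); split.
- by move=> i; case: (split i).
- by move=> i; case: (split i).
rewrite big_split_ord; congr (_ + _); apply: eq_bigr => i _.
  by rewrite (unsplitK (inl i)).
by rewrite (unsplitK (inr i)).
Qed.

Lemma idealM_sum (A : comNzRingType) (I J : set A) (T : Type) (r : seq T)
    (P : pred T) (F : T -> A) :
  (forall i, P i -> idealM I J (F i)) -> idealM I J (\sum_(i <- r | P i) F i).
Proof.
move=> JF; apply: big_ind => // [|x y]; first exact: idealM0.
exact: idealM_add.
Qed.

(** Stated for arbitrary sets, since it serves for extensions of powers of [I] to a localization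
    inside the fraction field. *)
Lemma idealM_mul (A : comNzRingType) (I I' J L : set A) x y :
  (forall a b, I a -> I' b -> J (a * b)) ->
  (forall a b, L a -> L b -> L (a * b)) ->
  idealM I L x -> idealM I' L y -> idealM J L (x * y).
Proof.
move=> IJ LL [n [a [b [Ia Lb ->]]]] [m [c [d [Ic Ld ->]]]].
rewrite big_distrl; apply: idealM_sum => i _.
rewrite big_distrr; apply: idealM_sum => j _.
by rewrite /= mulrACA; apply: idealM_unit; [apply: IJ|apply: LL].
Qed.

Lemma idealM_ideal (A : comNzRingType) (I J : set A) :
  ideal J -> ideal (idealM I J).
Proof.
move=> idJ; split; first exact: idealM0.
move=> e x y [n [a [b [Ia Jb ->]]]] Jy; apply: idealM_add => //.
rewrite big_distrr; apply: idealM_sum => i _ /=.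
by rewrite mulrCA; apply: idealM_unit => //; apply: idealMl.
Qed.

Lemma idealM_subset (A : comNzRingType) (I J H : set A) :
  ideal H -> (forall a b, I a -> J b -> H (a * b)) -> idealM I J `<=` H.
Proof.
move=> idH IJH x [n [a [b [Ia Jb ->]]]].
by apply: ideal_sum => // i _; apply: IJH.
Qed.

Lemma idealX_ideal (A : comNzRingType) (I : set A) n : ideal (idealX I n).
Proof. by elim: n => [|n IH]; [by split|exact: idealM_ideal]. Qed.

Lemma idealX_mull (A : comNzRingType) (I : set A) n a x :
  idealX I n x -> idealX I n (a * x).
Proof. exact: idealMl (idealX_ideal _ _). Qed.

Lemma idealX_mul (A : comNzRingType) (I : set A) a b x y :
  idealX I a x -> idealX I b y -> idealX I (a + b) (x * y).
Proof.
elim: a x => [|a IH] x; first by move=> _ /idealX_mull; apply.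
move=> [n [c [d [Ic Xd ->]]]] Xy; rewrite big_distrl addSn.
apply: (@idealM_sum _ I (idealX I (a + b))) => i _ /=.
by rewrite -mulrA; apply: idealM_unit => //; exact: IH (Xd i) Xy.
Qed.

Lemma idealX_exp (A : comNzRingType) (I : set A) a k x :
  idealX I a x -> idealX I (a * k) (x ^+ k).
Proof.
move=> Xx; elim: k => [|k IH]; first by rewrite muln0.
by rewrite exprS mulnS; apply: idealX_mul.
Qed.

Lemma idealX1 (A : comNzRingType) (I : set A) x : I x -> idealX I 1 x.
Proof. by move=> Ix; rewrite -[x]mulr1; apply: idealM_unit. Qed.

Lemma idealX_le (A : comNzRingType) (I : set A) a b :
  (a <= b)%N -> idealX I b `<=` idealX I a.
Proof.
move/subnKC <-; elim: (b - a)%N => [|c IH]; first by rewrite addn0.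
rewrite addnS => x Xx; apply: IH; move: x Xx.
by apply: idealM_subset => [|u v _]; [exact: idealX_ideal|exact: idealX_mull].
Qed.

Lemma idealX_mmap1 (A : comNzRingType) (I : set A) s (g : 'I_s -> A)
    (m : 'X_{1..s}) :
  (forall i, I (g i)) -> idealX I (mdeg m) (mmap1 g m).
Proof.
move=> Ig; rewrite mdegE /mmap1.
apply: (big_ind2 (fun x n => idealX I n x)) => //.
  by move=> x n y n' Xx Xy; apply: idealX_mul.
by move=> i _; rewrite -[X in idealX _ X]mul1n; apply/idealX_exp/idealX1.
Qed.

Lemma mmap1M (A : comNzRingType) s (g : 'I_s -> A) (m m' : 'X_{1..s}) :
  mmap1 g (m + m')%MM = mmap1 g m * mmap1 g m'.
Proof. by apply: commr_mmap1_M => i x; apply: mulrC. Qed.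

Lemma mmap1Mn (A : comNzRingType) s (g : 'I_s -> A) (m : 'X_{1..s}) k :
  mmap1 g (m *+ k)%MM = mmap1 g m ^+ k.
Proof.
elim: k => [|k IH]; first by rewrite mulm0n mmap11.
by rewrite mulmS mmap1M IH exprS.
Qed.

Lemma rmorph_mmap1 (A B : comNzRingType) (f : {rmorphism A -> B}) s
    (g : 'I_s -> A) (m : 'X_{1..s}) :
  f (mmap1 g m) = mmap1 (f \o g) m.
Proof. by rewrite /mmap1 rmorph_prod; apply: eq_bigr => i _; rewrite rmorphXn. Qed.

Definition generated_by (A : comNzRingType) (I : set A) s (g : 'I_s -> A) : Prop :=
  (forall i, I (g i)) /\
  forall x, I x -> exists c : 'I_s -> A, x = \sum_i c i * g i.

Lemma idealX_span (A : comNzRingType) (I : set A) s (g : 'I_s -> A) M :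
  generated_by I g ->
  idealX I M `<=` idealM [set mmap1 g m | m in [set m | mdeg m = M]] setT.
Proof.
move=> [Ig Igen]; elim: M => [|M IH] x.
  move=> _; rewrite -[x]mul1r; apply: idealM_unit => //.
  by exists 0%MM; [exact: mdeg0|rewrite mmap11].
apply: idealM_subset; first by apply: idealM_ideal; split.
move=> a b /Igen[c ->] /IH[n [u [v [Hu _ ->]]]].
rewrite big_distrl; apply: idealM_sum => j _ /=.
rewrite big_distrr; apply: idealM_sum => i _ /=.
rewrite [c j * _]mulrC mulrACA; apply: idealM_unit => //.
have [m dm <-] := Hu i; exists (U_(j) + m)%MM.
  by rewrite /= mdegD mdeg1 dm.
by rewrite mmap1M mmap1U.
Qed.

(** * Briancon-Skoda in positive characteristic *)

Lemma mcoeffMXE n (R : nzRingType) (p : {mpoly R[n]}) m k :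
  (p * 'X_[m])@_k = if (m <= k)%MM then p@_(k - m) else 0.
Proof.
case: ifP => [/submK lemk|lemk]; first by rewrite -{1}lemk addmC mcoeffMX.
apply: memN_msupp_eq0; rewrite (perm_mem (msuppMX _ _)).
by apply/negP => /mapP[m' _ kE]; rewrite kE lem_addr in lemk.
Qed.

Lemma pchar_exp_inj (k : fieldType) q :
  [pchar k].-nat q -> injective (fun x : k => x ^+ q).
Proof.
move=> qp x y /= xy; apply/eqP; rewrite -subr_eq0.
have := exprDn_pchar (x - y) y qp; rewrite subrK xy => /eqP.
by rewrite -subr_eq subrr eq_sym expf_eq0 => /andP[].
Qed.

Lemma closed_root (k : closedFieldType) (x : k) q :
  (0 < q)%N -> exists y, y ^+ q = x.
Proof.
case: q => // q q_gt0.
have [y yE] := solve_monicpoly (fun i => if i == 0%N then x else 0) q_gt0.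
exists y; rewrite yE big_ord_recl /= expr0 mulr1 big1 ?addr0 // => i _.
by rewrite mul0r.
Qed.

Lemma mpoly_exp_pchar n (k : fieldType) (p : {mpoly k[n]}) q :
  [pchar k].-nat q ->
  p ^+ q = \sum_(m <- msupp p) p@_m ^+ q *: 'X_[m *+ q].
Proof.
move=> qp; have q_gt0 : (0 < q)%N by case/andP: qp.
have qP : [pchar {mpoly k[n]}].-nat q by rewrite (eq_pnat _ (pchar_lalg _)).
rewrite {1}[p]mpolyE (big_morph (fun x => x ^+ q) (id1 := 0) (op1 := +%R)).
- by apply: eq_bigr => m _; rewrite exprZn mpolyXn.
- by move=> x y; rewrite exprDn_pchar.
- by rewrite expr0n eqn0Ngt q_gt0.
Qed.

(* Frobenius descent: taking [q]-th roots of the coefficients at the monomials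
   [b + q * m] is additive, divides [q]-th powers out, and sends [c] to a
   nonzero constant when [b] is the leading monomial of [c]. *)
Lemma frobenius_descent n (k : closedFieldType) q w (c f : {mpoly k[n]})
    (b h : 'I_w -> {mpoly k[n]}) :
  [pchar k].-nat q -> c != 0 -> (msize c <= q)%N ->
  c * f ^+ q = \sum_i b i * h i ^+ q ->
  exists b', f = \sum_i b' i * h i.
Proof.
move=> qp c0 szc cfE; have q_gt0 : (0 < q)%N by case/andP: qp.
pose F (x : k) := x ^+ q.
have Finj : injective F by apply: pchar_exp_inj.
have /choice[r rE] : forall x, exists y, F y = x.
  by move=> x; apply: closed_root.
have rD x y : r (x + y) = r x + r y.
  by apply: Finj; rewrite rE {1}/F exprDn_pchar // -!/(F _) !rE.
have rM x y : r (x * F y) = r x * y.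
  by apply: Finj; rewrite rE {2}/F exprMn -!/(F _) rE.
have r0 : r 0 = 0 by apply: Finj; rewrite rE /F expr0n eqn0Ngt q_gt0.
pose be := mlead c.
(* Since the exponents of [be] are below [q], [m *+ q] divides [be + m' *+ q] exactly when [m]
   divides [m']. *)
have be_lt i : (be i < q)%N.
  apply: leq_trans szc; rewrite -mlead_deg // ltnS mdegE.
  by rewrite (bigD1 i) //= leq_addr.
(* The bound on [m] loses nothing: [be + m *+ q] has at least the degree of [m], so beyond the bound
   its coefficient in [P] is zero. *)
pose E (P : {mpoly k[n]}) : {mpoly k[n]} :=
  \sum_(m : 'X_{1..n < msize P}) r P@_(be + m *+ q) *: 'X_[m].
have EE P m : (E P)@_m = r P@_(be + m *+ q).
  have [szm|szm] := ltnP (mdeg m) (msize P).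
    exact: (mcoeff_mpoly (fun m => r P@_(be + m *+ q))).
  have le_mq : (mdeg m <= mdeg (be + m *+ q))%N.
    by rewrite mdegD mdegMn (leq_trans (leq_pmulr _ q_gt0)) ?leq_addl.
  rewrite (memN_msupp_eq0 (msize_mdeg_ge (leq_trans szm le_mq))) r0.
  rewrite raddf_sum big1 //= => i _; rewrite mcoeffZ mcoeffX.
  have [im|] := eqVneq; last by rewrite mulr0.
  by have := bmdeg i; rewrite im ltnNge szm.
have ED P Q : E (P + Q) = E P + E Q.
  by apply/mpolyP => m; rewrite mcoeffD !EE mcoeffD rD.
have E0 : E 0 = 0 by apply/mpolyP => m; rewrite EE !mcoeff0 r0.
have Esum := big_morph E ED E0.
have EX P a m : E (P * (F a *: 'X_[m *+ q])) = E P * (a *: 'X_[m]).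
  apply/mpolyP => m'; rewrite EE -!scalerAr !mcoeffZ !mcoeffMXE EE mulrC.
  have -> : (m *+ q <= be + m' *+ q)%MM = (m <= m')%MM.
    apply/mnm_lepP/mnm_lepP => mm i; have := mm i; last first.
      by move=> le; rewrite mnmDE !mulmnE (leq_trans _ (leq_addl _ _)) ?leq_mul.
    rewrite mnmDE !mulmnE leqNgt => H; rewrite leqNgt; apply: contra H => H.
    rewrite (leq_trans _ (leq_mul H (leqnn q))) // mulSn ltn_add2r //.
  case: ifP => lemm; last by rewrite mul0r r0 mulr0.
  rewrite rM mulrC; congr (_ * r (P @_ _)); apply/mnmP => i.
  by rewrite mnmDE !mnmBE !mnmDE !mulmnE mnmBE mulnBl addnBA // leq_mul2r
    (mnm_lepP lemm) orbT.
have EM P Q : E (P * Q ^+ q) = E P * Q.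
  rewrite mpoly_exp_pchar // big_distrr Esum /= [in RHS](mpolyE Q) big_distrr.
  by apply: eq_bigr => m _; apply: EX.
(* For nonzero [m] the monomial [be + m *+ q] has degree at least [q], hence does not occur in
   [c]. *)
have Ec : E c = (r c@_be)%:MP.
  apply/mpolyP => m; rewrite EE mcoeffC; have [->|m0] := eqVneq m 0%MM.
    by rewrite mulr1; congr (r c @_ _); apply/mnmP => i;
       rewrite mnmDE mulmnE mnm0E mul0n addn0.
  rewrite mulr0 memN_msupp_eq0 // msize_mdeg_ge // (leq_trans szc) //.
  rewrite mdegD mdegMn (leq_trans _ (leq_addl _ _)) // leq_pmull //.
  by rewrite lt0n mdeg_eq0.
have rc0 : r c@_be != 0.
  apply/eqP => rc; have := rE c@_be; rewrite rc /F expr0n eqn0Ngt q_gt0 /=.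
  by move/esym/eqP; rewrite mleadc_eq0 (negPf c0).
exists (fun i => (r c@_be)^-1 *: E (b i)).
have /(congr1 E) := cfE; rewrite EM Esum Ec mul_mpolyC => cf.
rewrite -[f]scale1r -(mulVf rc0) -scalerA cf scaler_sumr.
by apply: eq_bigr => i _; rewrite EM scalerAl.
Qed.

(** A monomial of degree [q * (N + s)] in [s] generators is divisible by the [q]-th power of one of
    degree at least [N], as the remainders of its exponents modulo [q] add up to at most
    [s * (q - 1)]. Frobenius descent with [c = f ^+ j] then applies. *)
Lemma briancon_skoda_pchar n (k : closedFieldType) p (J : set {mpoly k[n]})
    s (g : 'I_s -> {mpoly k[n]}) f j N :
  p \in [pchar k] -> generated_by J g -> (0 < j)%N ->
  idealX J (j * (N + s)) (f ^+ j) -> idealX J N f.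
Proof.
move=> chp Jg j_gt0 Jf.
have [->|f0] := eqVneq f 0; first exact: ideal0 (idealX_ideal _ _).
have p_pr := pcharf_prime chp.
pose q := (p ^ msize (f ^+ j))%N.
have q_nat : [pchar k].-nat q by rewrite pnatX pnatE // chp.
have q_gt0 : (0 < q)%N by case/andP: q_nat.
have q_ge : (msize (f ^+ j) <= q)%N by apply/ltnW/ltn_expl/prime_gt1.
have Jq : idealX J (q * (N + s)) (f ^+ j * f ^+ q).
  (* [j * t] lies between [q] and [j + q], so [f ^+ (j + q)] is a multiple of [(f ^+ j) ^+ t]. *)
  pose t := (q %/ j).+1.
  have t_ge : (q <= j * t)%N by rewrite mulnC; apply/ltnW/ltn_ceil.
  have t_le : (j * t <= j + q)%N.
    by rewrite mulnS leq_add2l mulnC leq_trunc_div.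
  rewrite -exprD -(subnK t_le) exprD; apply: idealX_mull.
  apply: idealX_le (leq_mul t_ge (leqnn _)) _ _.
  by rewrite mulnAC exprM; apply: idealX_exp.
have [w [u [v [Hu _ fE]]]] := idealX_span Jg Jq.
have /choice[m mP] : forall i, exists m,
    mdeg m = (q * (N + s))%N /\ mmap1 g m = u i.
  by move=> i; have [m ? ?] := Hu i; exists m.
pose md i := [multinom (m i j' %/ q)%N | j' < s].
pose mr i := [multinom (m i j' %% q)%N | j' < s].
have mE i : m i = (md i *+ q + mr i)%MM.
  by apply/mnmP => j'; rewrite mnmDE mulmnE !mnmE -divn_eq.
have md_ge i : (N <= mdeg (md i))%N.
  have mr_le : (mdeg (mr i) <= s * q.-1)%N.
    rewrite mdegE -[s in (s * _)%N]card_ord -sum_nat_const.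
    by apply: leq_sum => j' _; rewrite mnmE -ltnS prednK ?ltn_pmod.
  have := (mP i).1; rewrite {1}mE mdegD mdegMn => dE.
  rewrite -(leq_pmul2r q_gt0) -(leq_add2r (s * q.-1)).
  rewrite (leq_trans _ (leq_add (leqnn _) mr_le)) // dE mulnDr mulnC leq_add2l.
  by rewrite mulnC leq_mul2r leq_pred orbT.
have [b' ->] : exists b', f = \sum_i b' i * mmap1 g (md i).
  apply: (@frobenius_descent _ _ q _ (f ^+ j) _
            (fun i => v i * mmap1 g (mr i))) => //.
    by rewrite expf_neq0.
  rewrite fE; apply: eq_bigr => i _; rewrite -(mP i).2 mE mmap1M mmap1Mn.
  by rewrite mulrC -mulrA [_ * mmap1 g (mr i)]mulrC.
apply: ideal_sum => [|i _]; first exact: idealX_ideal.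
apply: idealX_mull; apply: idealX_le (md_ge i) _ _.
exact: idealX_mmap1 Jg.1.
Qed.

(** * Specialization to positive characteristic *)

(** The inclusion of kernels encodes a map out of the image of [al]. The freedom in [u] carries the
    induction over adjoined elements. *)
Definition specializable (A : idomainType) (K : fieldType)
    (al : {rmorphism A -> K}) : Prop :=
  forall u, al u != 0 ->
  exists p (k : closedFieldType) (be : {rmorphism A -> k}),
    [/\ p \in [pchar k], forall x, al x = 0 -> be x = 0 & be u != 0].

Lemma intr_eq0_absz (K : nzRingType) (x : int) :
  (x%:~R == 0 :> K) = ((`|x|%N)%:R == 0 :> K).
Proof.
rewrite [x in LHS]intEsign rmorphM /= rmorph_sign mulr_sign.
by case: (x < 0); rewrite ?oppr_eq0.
Qed.

Lemma specializable_int (K : fieldType) (al : {rmorphism int -> K}) :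
  specializable al.
Proof.
have al_abs x : (al x == 0) = ((`|x|%N)%:R == 0 :> K).
  by rewrite -intr_eq0_absz -[x in LHS]intz rmorph_int.
move=> u; rewrite al_abs => u0.
(* [p] is the characteristic of [K] if that is positive, and otherwise a prime larger than the
   absolute value of [u]. *)
have [p [p_pr pu pK]] : exists p, [/\ prime p, ~~ (p %| `|u|)%N &
    forall x, al x = 0 -> (p %| `|x|)%N].
  have [[p pK]|K0] := EM (exists p, p \in [pchar K]).
    exists p; rewrite (dvdn_pcharf pK) u0 (pcharf_prime pK); split=> // x /eqP.
    by rewrite al_abs (dvdn_pcharf pK).
  have [p up p_pr] := prime_above `|u|; exists p; split=> //.
    rewrite gtnNdvd // lt0n; apply: contra u0 => /eqP->.
    by rewrite eqxx.
  move=> x /eqP; rewrite al_abs => x0.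
  have [->//|x1] := posnP `|x|%N.
  by have [q qK] := natf0_pchar x1 x0; case: K0; exists q.
have [k [FpK _]] := countable_algebraic_closure 'F_p.
have kp : p \in [pchar k] by rewrite (fmorph_pchar FpK) pchar_Fp.
exists p, k, (intr : {rmorphism int -> k}); split=> // [x /pK|].
  by rewrite (dvdn_pcharf kp) -intr_eq0_absz => /eqP.
by rewrite intr_eq0_absz -(dvdn_pcharf kp).
Qed.

Lemma size_map_poly_leq (A B : nzRingType) (f : {rmorphism A -> B}) (P : {poly A}) :
  (size (map_poly f P) <= size P)%N.
Proof. exact: size_poly. Qed.

Lemma map_poly_trunc (A : nzRingType) (K : nzRingType) (al : {rmorphism A -> K})
    (P : {poly A}) :
  exists P', map_poly al P' = map_poly al P /\ size P' = size (map_poly al P').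
Proof.
exists (\poly_(i < size (map_poly al P)) P`_i).
have E : map_poly al (\poly_(i < size (map_poly al P)) P`_i) = map_poly al P.
  apply/polyP => i; rewrite !coef_map coef_poly /=.
  by case: ltnP => // szi; rewrite rmorph0 -(coef_map al) nth_default.
by split=> //; apply/eqP; rewrite eqn_leq size_map_poly_leq andbT E size_poly.
Qed.

(** [Q] stands in for the minimal polynomial of [a] over the fraction field of the image of [al]. If
    [al] killed its leading coefficient, truncation would give a smaller annihilator. *)
Lemma min_annihilator (A : idomainType) (K : fieldType) (al : {rmorphism A -> K})
    (a : K) (P : {poly A}) :
  map_poly al P != 0 -> (map_poly al P).[a] = 0 ->
  exists Q : {poly A}, [/\ al (lead_coef Q) != 0, (map_poly al Q).[a] = 0 &
    forall S : {poly A}, (map_poly al S).[a] = 0 -> (size S < size Q)%N ->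
    map_poly al S = 0].
Proof.
elim/ltn_ind: {P}(size P) {-2}P (erefl (size P)) => n IH P szP P0 Pa.
have [[S [S0 Sa szS]]|noS] := EM (exists S : {poly A}, [/\ map_poly al S != 0,
    (map_poly al S).[a] = 0 & (size S < n)%N]); first exact: IH szS S erefl S0 Sa.
exists P; split=> // [|S Sa szS]; last first.
  apply/eqP/negPn/negP => S0; apply: noS; exists S.
  by rewrite S0 Sa -szP.
have [P' [P'E szP']] := map_poly_trunc al P.
have le : (n <= size (map_poly al P))%N.
  rewrite leqNgt; apply/negP => lt; apply: noS; exists P'.
  by rewrite P'E szP' P'E.
have szE : size (map_poly al P) = size P.
  by apply/eqP; rewrite eqn_leq size_map_poly_leq szP.
by rewrite lead_coefE -szE -(coef_map al) -lead_coefE lead_coef_eq0.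
Qed.

(** A Euclidean descent by pseudo-division: [U] is replaced by ever shorter remainders that stay
    nonzero at [a], until a constant is left. Any specialization of [a] that respects this relation
    and keeps [v] nonzero also keeps [U] nonzero. *)
Lemma nonzero_multiple (A : idomainType) (K : fieldType)
    (al : {rmorphism A -> K}) (a : K) (P U : {poly A}) :
  al (lead_coef P) != 0 -> (map_poly al P).[a] = 0 ->
  (forall S : {poly A}, (map_poly al S).[a] = 0 -> (size S < size P)%N ->
    map_poly al S = 0) ->
  (map_poly al U).[a] != 0 ->
  exists T v, (map_poly al (T * U)).[a] = al v /\ al v != 0.
Proof.
move=> P0 Pa Pmin; elim/ltn_ind: {U}(size U) {-2}U (erefl (size U)) => n IH U.
move=> szU Ua; have [U' [U'E szU']] := map_poly_trunc al U.
suff [T [v [TE v0]]] : exists T v, (map_poly al (T * U')).[a] = al v /\ al v != 0.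
  by exists T, v; rewrite rmorphM /= -U'E -rmorphM.
have szU'n : (size U' <= n)%N by rewrite szU' U'E -szU size_map_poly_leq.
move: Ua; rewrite -U'E => {U'E U szU} U'a.
have lcU0 : al (lead_coef U') != 0.
  rewrite lead_coefE szU' -(coef_map al) -lead_coefE lead_coef_eq0.
  by apply: contraNneq U'a => ->; rewrite horner0.
have nz (Q : {poly A}) : al (lead_coef Q) != 0 -> Q != 0.
  by apply: contraNneq => ->; rewrite lead_coef0 rmorph0.
have [szPU|szUP] := leqP (size P) (size U').
  have := Pdiv.Idomain.divp_eq U' P => /(congr1 (fun Q => (map_poly al Q).[a])).
  rewrite rmorphD rmorphM /= hornerD hornerM Pa mulr0 add0r => RE.
  have R0 : (map_poly al (U' %% P)%R).[a] != 0.
    by rewrite -RE -mul_polyC rmorphM /= map_polyC hornerM hornerC mulf_neq0 //=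
      rmorphXn expf_neq0.
  have [|T [v [Tv v0]]] := IH _ _ _ (erefl _) R0.
    by rewrite (leq_trans _ szU'n) // (leq_trans _ szPU) // ltn_modp nz.
  exists (T * (lead_coef P ^+ scalp U' P)%:P), v; split=> //.
  by rewrite -Tv -mulrA mul_polyC !rmorphM /= !hornerM RE.
have [szU1|szU1] := leqP (size U') 1.
  exists 1, U'`_0; rewrite mul1r; move: U'a; rewrite (size1_polyC szU1).
  by rewrite map_polyC hornerC coefC.
have := Pdiv.Idomain.divp_eq P U' => PE.
have szR : (size (P %% U')%R < size U')%N by rewrite ltn_modp nz.
have := congr1 (fun Q => (map_poly al Q).[a]) PE.
rewrite -mul_polyC rmorphD !rmorphM /= hornerD !hornerM Pa mulr0 => QR.
(* If the remainder vanishes at [a], then by minimality [al] kills it and also the quotient, hence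
   the leading coefficient of [P], a contradiction. *)
have [Ra|R0] := eqVneq (map_poly al (P %% U')%R).[a] 0; last first.
  have [|T [v [Tv v0]]] := IH _ _ _ (erefl _) R0.
    exact: leq_trans szU'n.
  exists (- (T * (P %/ U')%R)), v; split=> //; rewrite -Tv.
  rewrite mulNr rmorphN !rmorphM /= hornerN !hornerM -mulrA.
  by move/esym/eqP: QR; rewrite addr_eq0 => /eqP->; rewrite mulrN opprK.
have R0 := Pmin _ Ra (ltn_trans szR szUP).
move/esym/eqP: QR; rewrite Ra addr0 mulf_eq0 (negPf U'a) orbF => /eqP Qa.
have Q0 : map_poly al (P %/ U')%R = 0.
  apply: Pmin Qa _; rewrite size_divp ?nz //.
  by rewrite ltn_subrL -subn1 subn_gt0 szU1 (leq_ltn_trans _ szUP).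
have := congr1 (map_poly al) PE.
rewrite -mul_polyC rmorphD !rmorphM /= R0 Q0 mul0r addr0 map_polyC => /eqP.
rewrite mulf_eq0 polyC_eq0 /= rmorphXn expf_eq0 (negPf lcU0) andbF /=.
by move/eqP/(congr1 (fun Q : {poly K} => Q`_(size P).-1)); rewrite coef0 coef_map
  -lead_coefE => /eqP; rewrite (negPf P0).
Qed.

Lemma specializable_adjoin (A : idomainType) (K : fieldType)
    (al : {rmorphism A -> K}) (a : K) (al' : {rmorphism {poly A} -> K}) :
  (forall P, al' P = (map_poly al P).[a]) ->
  specializable al -> specializable al'.
Proof.
move=> al'E spec U; rewrite al'E => Ua.
have beX (k : closedFieldType) (be : {rmorphism A -> k}) b :
    {be' : {rmorphism {poly A} -> k} | forall P, be' P = (map_poly be P).[b]}.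
  have cb : commr_rmorph be b by move=> x; apply: mulrC.
  by exists (horner_morph cb).
have [[P [P0 Pa]]|tr] := EM (exists P : {poly A},
    map_poly al P != 0 /\ (map_poly al P).[a] = 0); last first.
  (* Transcendental [a]: once a nonzero coefficient of [U] survives, any [b] that is not a root of
     the specialized [U] is a valid image of [a]. *)
  have U0 : map_poly al U != 0 by apply: contraNneq Ua => ->; rewrite horner0.
  have [|p [k [be [kp ker Ube]]]] := spec U`_(size (map_poly al U)).-1.
    by rewrite -(coef_map al) -lead_coefE lead_coef_eq0.
  have [b Ub] : exists b, ~~ root (map_poly be U) b.
    apply/closed_nonrootP; apply: contraNneq Ube => U0'.
    by rewrite -(coef_map be) U0' coef0.
  have [be' be'E] := beX k be b.
  exists p, k, be'; rewrite be'E; split=> // Q; rewrite al'E be'E => Qa.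
  suff -> : map_poly be Q = 0 by rewrite horner0.
  have [Q0|Q0] := eqVneq (map_poly al Q) 0; last by case: tr; exists Q.
  apply/polyP => i; rewrite coef_map coef0.
  by apply: ker; rewrite -(coef_map al) Q0 coef0.
have {P P0 Pa} [P [P0 Pa Pmin]] := min_annihilator P0 Pa.
have [T [v [Tv v0]]] := nonzero_multiple P0 Pa Pmin Ua.
(* Algebraic [a]: it is sent to a root [b] of the specialized [P]. Keeping [lead_coef P] nonzero
   provides the root and lets pseudo-division by [P] transfer the kernel; keeping [v] nonzero
   protects [U]. *)
have [|p [k [be [kp ker]]]] := spec (v * lead_coef P).
  by rewrite rmorphM mulf_neq0.
rewrite rmorphM mulf_eq0 negb_or => /andP[bv bP].
have szP : size (map_poly be P) = size P by rewrite size_map_poly_id0.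
have [b Pb] : exists b, root (map_poly be P) b.
  apply/closed_rootP; rewrite szP; apply: contraNneq P0 => szP1.
  have /size1_polyC PE : (size P <= 1)%N by rewrite szP1.
  move: Pa; rewrite PE map_polyC hornerC => Pa.
  by rewrite lead_coefC Pa.
have [be' be'E] := beX k be b.
have ker' Q : al' Q = 0 -> be' Q = 0.
  rewrite al'E be'E => Qa.
  have QE := Pdiv.Idomain.divp_eq Q P.
  have := congr1 (fun Q => (map_poly al Q).[a]) QE.
  rewrite -mul_polyC rmorphD !rmorphM /= hornerD !hornerM Pa Qa !mulr0 add0r.
  move/esym => Ra; have nzP : P != 0.
    by apply: contraNneq P0 => ->; rewrite lead_coef0 rmorph0.
  have R0 := Pmin _ Ra; rewrite ltn_modp in R0; have {}R0 := R0 nzP.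
  have R0' : map_poly be (Q %% P)%R = 0.
    apply/polyP => i; rewrite coef_map coef0.
    by apply: ker; rewrite -(coef_map al) R0 coef0.
  have := congr1 (fun Q => (map_poly be Q).[b]) QE.
  rewrite -mul_polyC rmorphD !rmorphM /= hornerD !hornerM (rootP Pb) R0' horner0.
  rewrite mulr0 addr0 map_polyC hornerC /= rmorphXn => /eqP.
  by rewrite mulf_eq0 expf_eq0 (negPf bP) andbF => /eqP.
exists p, k, be'; split=> //.
have /ker' : al' (T * U - v%:P) = 0.
  by rewrite rmorphB !al'E Tv map_polyC hornerC subrr.
rewrite rmorphB rmorphM /= be'E [be' v%:P]be'E map_polyC hornerC => /eqP.
rewrite subr_eq0 be'E => /eqP TUv.
by apply: contraNneq bv => Ub; rewrite -TUv Ub mulr0.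
Qed.

Lemma specialization (K : fieldType) (l : seq K) :
  exists (A : idomainType) (al : {rmorphism A -> K}) (p : nat)
    (k : closedFieldType) (be : {rmorphism A -> k}),
    [/\ p \in [pchar k], forall x, al x = 0 -> be x = 0 &
      forall x, x \in l -> exists y, al y = x].
Proof.
suff [A [al [spec lP]]] : exists (A : idomainType) (al : {rmorphism A -> K}),
    specializable al /\ forall x, x \in l -> exists y, al y = x.
  have [|p [k [be [kp ker _]]]] := spec 1; first by rewrite rmorph1 oner_neq0.
  by exists A, al, p, k, be.
elim: l => [|a l [A [al [spec lP]]]].
  by exists int, (intr : {rmorphism int -> K}); split=> //; apply: specializable_int.
have ca : commr_rmorph al a by move=> x; apply: mulrC.
exists {poly A}, (horner_morph ca); split.
  exact: (specializable_adjoin (a := a)) spec.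
move=> x; rewrite inE => /predU1P[->|/lP[y <-]].
  by exists 'X; apply: horner_morphX.
by exists y%:P; apply: horner_morphC.
Qed.

(** * The Briancon-Skoda theorem for homogeneous ideals *)

(** If [v] is outside the row space of [M], some column of the cokernel matrix pairs nontrivially
    with [v] and is rescaled to [l]. This certificate consists of finitely many equations, so it can
    be specialized. *)
Lemma fredholm_alternative (K : fieldType) (X Y : finType) (M : X -> Y -> K)
    (v : Y -> K) :
  (exists w : X -> K, forall y, \sum_x w x * M x y = v y) \/
  (exists l : Y -> K, (forall x, \sum_y M x y * l y = 0) /\
     \sum_y v y * l y = 1).
Proof.
pose A := \matrix_(i < #|X|, j < #|Y|) M (enum_val i) (enum_val j).
pose r := \row_(j < #|Y|) v (enum_val j).
have sumE (Z : finType) (F : Z -> K) : \sum_z F z = \sum_(i < #|Z|) F (enum_val i).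
  by rewrite (reindex (@enum_val Z Z)) //; apply/onW_bij/enum_val_bij.
case: (boolP (r <= A)%MS) => [/submxP[D rE]|].
  left; exists (fun x => D 0 (enum_rank x)) => y.
  have /matrixP/(_ 0 (enum_rank y)) := rE; rewrite !mxE enum_rankK => ->.
  by rewrite sumE; apply: eq_bigr => i _; rewrite mxE enum_valK enum_rankK.
rewrite submxE => /rowV0Pn[_ /sub_rVP[a ->]].
rewrite scaler_eq0 negb_or => /andP[_ /rV0Pn[j cj]].
pose c := (r *m cokermx A) 0 j; right.
exists (fun y => cokermx A (enum_rank y) j / c); split=> [x|].
  have /matrixP/(_ (enum_rank x) j) := mulmx_coker A; rewrite !mxE => A0.
  rewrite [LHS]sumE -[RHS](mul0r c^-1) -[X in _ = X * _]A0 mulr_suml.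
  by apply: eq_bigr => i _; rewrite !mxE enum_valK ?enum_rankK mulrA.
have cE : c = \sum_y v y * cokermx A (enum_rank y) j.
  by rewrite /c mxE [RHS]sumE; apply: eq_bigr => i _; rewrite mxE enum_valK.
rewrite -(divff cj) -/c [X in _ = X / _]cE mulr_suml.
by apply: eq_bigr => y _; rewrite mulrA.
Qed.

Lemma mcoeff_pihomog n (K : fieldType) d (p : {mpoly K[n]}) m :
  (pihomog mdeg d p)@_m = if mdeg m == d then p@_m else 0.
Proof.
pose k := maxn (msize p) (mdeg m).+1.
rewrite (@pihomogwE _ _ _ _ k) ?leq_maxl // big_mkcond /=.
rewrite -(@mcoeff_mpoly _ _ (fun m => if mdeg m == d then p@_m else 0) m k).
  congr mcoeff; apply: eq_bigr => m' _.
  by case: ifP => //; rewrite scale0r.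
by rewrite leq_maxr.
Qed.

Lemma idealM_homogeneous n (K : fieldType) (I J : set {mpoly K[n]}) :
  homogeneous_ideal I -> homogeneous_ideal J -> homogeneous_ideal (idealM I J).
Proof.
move=> hI hJ p d [w [a [b [Ia Jb ->]]]].
rewrite linear_sum; apply: idealM_sum => i _ /=.
rewrite [a i](@pihomog_partitionE _ _ mdeg (msize (a i))) // big_distrl /=.
rewrite linear_sum; apply: idealM_sum => d1 _ /=.
rewrite [b i](@pihomog_partitionE _ _ mdeg (msize (b i))) // big_distrr /=.
rewrite linear_sum; apply: idealM_sum => d2 _ /=.
have hom : pihomog mdeg d1 (a i) * pihomog mdeg d2 (b i) \is (d1 + d2).-homog.
  by apply: dhomogM; apply: pihomogP.
have [de|dne] := eqVneq (d1 + d2)%N d.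
  by rewrite pihomog_dE -?de //; apply: idealM_unit; [apply: hI|apply: hJ].
by rewrite (pihomog_ne0 dne) //; apply: idealM0.
Qed.

Lemma idealX_homogeneous n (K : fieldType) (I : set {mpoly K[n]}) N :
  homogeneous_ideal I -> homogeneous_ideal (idealX I N).
Proof. by move=> hI; elim: N => [|N IH] //; apply: idealM_homogeneous. Qed.

(** [f] is the sum of the components of [h] of degree below [msize f]. Membership in [J] thus
    becomes a question about finitely many coefficients. *)
Lemma homogeneous_truncation n (K : fieldType) (J : set {mpoly K[n]})
    (f h : {mpoly K[n]}) :
  ideal J -> homogeneous_ideal J -> J h ->
  (forall m, (mdeg m < msize f)%N -> f@_m = h@_m) -> J f.
Proof.
move=> idJ hJ Jh fh; rewrite (@pihomog_partitionE _ _ mdeg (msize f) f) //.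
apply: ideal_sum => // d _.
have -> : pihomog mdeg d f = pihomog mdeg d h.
  apply/mpolyP => m; rewrite !mcoeff_pihomog; case: eqP => // md.
  by apply: fh; rewrite md.
exact: hJ.
Qed.

Lemma map_mpoly_lift n (A K : nzRingType) (al : {rmorphism A -> K})
    (P : {mpoly K[n]}) :
  (forall m, m \in msupp P -> exists y, al y = P@_m) ->
  exists Q : {mpoly A[n]}, map_mpoly al Q = P.
Proof.
move=> PA; have /choice[r rE] : forall m, exists y, m \in msupp P -> al y = P@_m.
  move=> m; have [/PA[y yE]|_] := boolP (m \in msupp P); last by exists 0.
  by exists y.
exists (\sum_(m <- msupp P) r m *: 'X_[m]).
rewrite raddf_sum [RHS]mpolyE /=; apply: eq_big_seq => m /rE <-.
by rewrite map_mpolyZ map_mpolyX.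
Qed.

(* If [f] is not in [I ^ N], homogeneity provides a linear form in the
   coefficients of degree [< msize f] separating them.  The finitely many
   coefficients involved specialize to positive characteristic, where the form
   contradicts [briancon_skoda_pchar]. *)
Lemma briancon_skoda n (K : fieldType) (I : set {mpoly K[n]}) s
    (g : 'I_s -> {mpoly K[n]}) f j N :
  homogeneous_ideal I -> generated_by I g -> (0 < j)%N ->
  idealX I (j * (N + s)) (f ^+ j) -> idealX I N f.
Proof.
move=> hI Ig j_gt0 fj.
pose D := msize f.
(* The index type below contains all degrees up to [N]; those below [N] contribute zero. *)
pose h (u : 'X_{1..s}) := if mdeg u == N then mmap1 g u else 0.
have [[w wE]|[l [l0 l1]]] := fredholm_alternative
    (fun (x : 'X_{1..s < N.+1} * 'X_{1..n < D}) (y : 'X_{1..n < D}) =>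
       ('X_[x.2] * h x.1)@_y) (fun y => f@_y).
  apply: (@homogeneous_truncation _ _ _ _ (\sum_x w x *: ('X_[x.2] * h x.1))).
  - exact: idealX_ideal.
  - exact: idealX_homogeneous.
  - apply: ideal_sum => [|x _]; first exact: idealX_ideal.
    rewrite -mul_mpolyC mulrA; apply: idealX_mull; rewrite /h.
    case: eqP => [dx|_]; first by have := idealX_mmap1 x.1 Ig.1; rewrite dx.
    exact: ideal0 (idealX_ideal _ _).
  - move=> m szm; rewrite -[m]/(val (BMultinom szm)) -wE raddf_sum /=.
    by apply: eq_bigr => x _; rewrite mcoeffZ.
exfalso.
have [w [u0 [v [Hu _ fE]]]] := idealX_span Ig fj.
have /choice[u uP] : forall i, exists m,
    mdeg m = (j * (N + s))%N /\ mmap1 g m = u0 i.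
  by move=> i; have [m ? ?] := Hu i; exists m.
pose cf (P : {mpoly K[n]}) := [seq P@_m | m <- msupp P].
(* The list collects the scalars of the identity for [f ^+ j] and of the separating form [l]. *)
have [A [al [p [k [be [kp ker lP]]]]]] := specialization
  (cf f ++ flatten [seq cf (g i) | i <- enum 'I_s] ++
   flatten [seq cf (v i) | i <- enum 'I_w] ++
   [seq l y | y <- enum {: 'X_{1..n < D}}]).
have [f' f'E] : exists Q : {mpoly A[n]}, map_mpoly al Q = f.
  apply: map_mpoly_lift => m mf; apply: lP.
  by rewrite mem_cat (map_f (fun m => f@_m)).
have /choice[g' g'E] : forall i, exists Q : {mpoly A[n]}, map_mpoly al Q = g i.
  move=> i; apply: map_mpoly_lift => m mf; apply: lP; rewrite !mem_cat.
  apply/or3P/Or32/flatten_mapP; exists i; rewrite ?mem_enum //.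
  exact: (map_f (fun m => (g i)@_m)).
have /choice[v' v'E] : forall i, exists Q : {mpoly A[n]}, map_mpoly al Q = v i.
  move=> i; apply: map_mpoly_lift => m mf; apply: lP; rewrite !mem_cat.
  apply/or4P/Or43/flatten_mapP; exists i; rewrite ?mem_enum //.
  exact: (map_f (fun m => (v i)@_m)).
have /choice[l' l'E] : forall y, exists a, al a = l y.
  move=> y; apply: lP; rewrite !mem_cat.
  by apply/or4P/Or44; apply: map_f; rewrite mem_enum.
have kerP (P : {mpoly A[n]}) : map_mpoly al P = 0 -> map_mpoly be P = 0.
  move=> P0; apply/mpolyP => m; rewrite mcoeff_map_mpoly mcoeff0.
  by apply: ker; rewrite -mcoeff_map_mpoly P0 mcoeff0.
have map_g (B : comNzRingType) (ph : {rmorphism A -> B})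
    (G : 'I_s -> {mpoly B[n]}) m :
    (forall i, map_mpoly ph (g' i) = G i) ->
    map_mpoly ph (mmap1 g' m) = mmap1 G m.
  by move=> GE; rewrite rmorph_mmap1; apply: mmap1_eq.
pose gk i := map_mpoly be (g' i).
pose J := [set x | exists c : 'I_s -> {mpoly k[n]}, x = \sum_i c i * gk i].
have Jg : generated_by J gk.
  split=> [i|x //]; exists (fun i' => (i' == i)%:R).
  by rewrite (bigD1 i) //= eqxx mul1r big1 ?addr0 // => i' /negPf->; rewrite mul0r.
have Jf : idealX J (j * (N + s)) (map_mpoly be f' ^+ j).
  have /kerP : map_mpoly al (f' ^+ j - \sum_i mmap1 g' (u i) * v' i) = 0.
    rewrite rmorphB rmorphXn /= f'E fE; apply/eqP; rewrite subr_eq0.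
    rewrite [X in _ == X]rmorph_sum; apply/eqP/eq_bigr => i _.
    by rewrite rmorphM /= v'E (map_g _ _ g) // (uP i).2.
  rewrite rmorphB rmorphXn => /subr0_eq ->.
  rewrite rmorph_sum; apply: ideal_sum => [|i _]; first exact: idealX_ideal.
  rewrite /= rmorphM /= (map_g _ _ gk) // mulrC; apply: idealX_mull.
  by rewrite -(uP i).1; apply: idealX_mmap1 Jg.1.
have {Jf} := briancon_skoda_pchar kp Jg j_gt0 Jf.
case/(idealX_span Jg) => [w' [z0 [b [Hz _ fkE]]]].
have /choice[z zP] : forall i, exists m, mdeg m = N /\ mmap1 gk m = z0 i.
  by move=> i; have [m ? ?] := Hz i; exists m.
(* The separating form, transported along [ph]. Over [k] it is 1 at the specialized [f], yet 0 on
   each term of its expansion in the [N]-th power of [J]. *)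
pose La (B : nzRingType) (ph : A -> B) (P : {mpoly B[n]}) :=
  \sum_(y : 'X_{1..n < D}) P@_y * ph (l' y).
have LaE (B : nzRingType) (ph : {rmorphism A -> B}) P :
    La B ph (map_mpoly ph P) = ph (\sum_(y : 'X_{1..n < D}) P@_y * l' y).
  rewrite rmorph_sum; apply: eq_bigr => y _.
  by rewrite mcoeff_map_mpoly rmorphM.
have LaB (P : {mpoly A[n]}) c : La K al (map_mpoly al P) = al c ->
    La k be (map_mpoly be P) = be c.
  rewrite !LaE => /eqP; rewrite -subr_eq0 -rmorphB => /eqP/ker/eqP.
  by rewrite rmorphB subr_eq0 => /eqP.
have La_sum (T : Type) (r : seq T) (F : T -> {mpoly k[n]}) :
    La k be (\sum_(i <- r) F i) = \sum_(i <- r) La k be (F i).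
  rewrite exchange_big; apply: eq_bigr => y _.
  by rewrite raddf_sum mulr_suml.
have /LaB : La K al (map_mpoly al f') = al 1.
  by rewrite rmorph1 -l1 f'E; apply: eq_bigr => y _; rewrite l'E.
rewrite fkE La_sum rmorph1 big1 => [/esym/eqP|i _]; first by rewrite oner_eq0.
rewrite -(zP i).2 [b i]mpolyE big_distrr La_sum big1 //= => m _.
rewrite -scalerAr /La; under eq_bigr do rewrite mcoeffZ -mulrA.
rewrite -mulr_sumr; apply/eqP; rewrite mulf_eq0; apply/orP; right; apply/eqP.
(* A multiplier of degree at least [D] only affects coefficients that the form ignores; a smaller
   one is covered by [l0]. *)
have [szm|szm] := ltnP (mdeg m) D; last first.
  apply: big1 => y _; rewrite mcoeffMXE ifF ?mul0r //.
  apply/negP => /lem_leo/lemc_mdeg my.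
  by have := leq_trans szm my; rewrite leqNgt bmdeg.
have alE : map_mpoly al (mmap1 g' (z i) * 'X_[m]) = mmap1 g (z i) * 'X_[m].
  by rewrite rmorphM /= map_mpolyX (map_g _ _ g).
have beE : map_mpoly be (mmap1 g' (z i) * 'X_[m]) = mmap1 gk (z i) * 'X_[m].
  by rewrite rmorphM /= map_mpolyX (map_g _ _ gk).
have := @LaB (mmap1 g' (z i) * 'X_[m]) 0.
rewrite alE beE !rmorph0; apply.
have szz : (mdeg (z i) < N.+1)%N by rewrite (zP i).1.
rewrite -[RHS](l0 (BMultinom szz, BMultinom szm)); apply: eq_bigr => y _.
by rewrite l'E /h /= (zP i).1 eqxx mulrC [_ * mmap1 _ _]mulrC mulrC.
Qed.

(** * The Hilbert basis theorem *)

Lemma bounded_tail_min (u : nat -> nat) N :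
  exists2 i, (N <= i)%N & forall j, (N <= j)%N -> (u i <= u j)%N.
Proof.
suff H v i : (N <= i)%N -> u i = v ->
    exists2 i, (N <= i)%N & forall j, (N <= j)%N -> (u i <= u j)%N.
  exact: (H _ N).
elim/ltn_ind: v i => v IH i Ni uv.
have [[j [Nj uj]]|nj] := EM (exists j, (N <= j)%N /\ (u j < v)%N).
  exact: IH uj _ Nj erefl.
exists i => // j Nj; rewrite uv leqNgt; apply/negP => uj.
by apply: nj; exists j.
Qed.

(** Each index picks a minimum of [u] over the tail beyond the previous index, so all later values
    are at least as large. *)
Lemma monotone_subsequence (u : nat -> nat) :
  exists2 phi : nat -> nat, {homo phi : i j / (i < j)%N} &
    {homo u \o phi : i j / (i <= j)%N}.
Proof.
have /choice[t tP] : forall N, exists i, (N <= i)%N /\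
    forall j, (N <= j)%N -> (u i <= u j)%N.
  by move=> N; have [i ? ?] := bounded_tail_min u N; exists i.
pose phi i := iter i (fun k => t k.+1) (t 0%N).
have phiS i : (phi i < phi i.+1)%N by rewrite /= (tP _).1.
have phi_t i : exists2 N, (N <= phi i)%N & phi i = t N.
  by case: i => [|i]; [exists 0%N|exists (phi i).+1; rewrite // ltnW].
exists phi; first by apply: homo_ltn => //; exact: ltn_trans.
apply: homo_leq => //=; [exact: leq_trans|move=> i].
have [N NP tN] := phi_t i; rewrite {1}tN; apply: (tP N).2.
exact: leq_trans NP (ltnW (phiS i)).
Qed.

(** Successive subsequences make the coordinates nondecreasing one after the other; after [n] rounds
    the first two terms are comparable. *)
Lemma dickson n (m : nat -> 'X_{1..n}) :
  exists i j, (i < j)%N /\ (m i <= m j)%MM.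
Proof.
suff H k : exists2 phi : nat -> nat, {homo phi : i j / (i < j)%N} &
    forall c : 'I_n, (c < k)%N -> {homo (fun i => m (phi i) c) : i j / (i <= j)%N}.
  have [phi phi_lt phi_le] := H n; exists (phi 0%N), (phi 1%N).
  split; first exact: phi_lt.
  by apply/mnm_lepP => c; apply: phi_le.
elim: k => [|k [phi phi_lt phi_le]]; first by exists id.
have [kn|nk] := ltnP k n; last first.
  exists phi => // c _; apply: phi_le.
  exact: leq_trans (ltn_ord c) nk.
have [psi psi_lt psi_le] := monotone_subsequence (fun i => m (phi i) (Ordinal kn)).
exists (phi \o psi) => [i j ij|c]; first exact/phi_lt/psi_lt.
rewrite ltnS leq_eqVlt => /predU1P[ck|ck] i j ij.
  by have -> : c = Ordinal kn; [exact: val_inj|exact: psi_le].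
apply: phi_le => //; move: ij; rewrite leq_eqVlt => /predU1P[->//|].
by move/psi_lt/ltnW.
Qed.

Definition span_seq (A : comNzRingType) (l : seq A) : set A :=
  [set x | exists c : 'I_(size l) -> A, x = \sum_i c i * l`_i].

Lemma span_seq_ideal (A : comNzRingType) (l : seq A) : ideal (span_seq l).
Proof.
split; first by exists (fun=> 0); rewrite big1 // => i _; rewrite mul0r.
move=> a x y [c ->] [d ->]; exists (fun i => a * c i + d i).
rewrite mulr_sumr -big_split; apply: eq_bigr => i _ /=.
by rewrite mulrDl mulrA.
Qed.

Lemma mem_span_seq (A : comNzRingType) (l : seq A) x : x \in l -> span_seq l x.
Proof.
move=> /(nthP 0)[i il <-]; exists (fun k => (k == Ordinal il)%:R).
rewrite (bigD1 (Ordinal il)) //= eqxx mul1r big1 ?addr0 // => k /negPf->.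
by rewrite mul0r.
Qed.

Lemma min_mlead n (K : fieldType) (S : set {mpoly K[n]}) f : S f ->
  exists2 g, S g & forall h, S h -> ~~ (mlead h < mlead g)%O.
Proof.
elim/(well_founded_induction (@ltom_wf n)): {f}(mlead f) {-2}f (erefl (mlead f)).
move=> m IH f fm Sf.
have [[h [Sh hf]]|nh] := EM (exists h, S h /\ (mlead h < m)%O).
  exact: IH hf _ erefl Sh.
exists f => // h Sh; rewrite fm; apply/negP => hf.
by apply: nh; exists h.
Qed.

(* A bad sequence, each term chosen outside the ideal of the previous ones with
   minimal leading monomial, contradicts Dickson's lemma. *)
Lemma hilbert_basis n (K : fieldType) (I : set {mpoly K[n]}) :
  ideal I -> exists s (g : 'I_s -> {mpoly K[n]}), generated_by I g.
Proof.
move=> idI; apply: contrapT => nfg.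
(* [F] gives the next term of the bad sequence; lists not contained in [I] get the default 0. *)
have /choice[F FP] : forall l : seq {mpoly K[n]}, exists f,
    (forall x, x \in l -> I x) ->
    [/\ I f, ~ span_seq l f &
     forall h, I h -> ~ span_seq l h -> ~~ (mlead h < mlead f)%O].
  move=> l; have [lI|nlI] := EM (forall x, x \in l -> I x); last by exists 0.
  have [f [If lf]] : exists f, I f /\ ~ span_seq l f.
    apply: contrapT => nf; apply: nfg; exists (size l), (fun i => l`_i).
    split=> [i|x Ix]; first exact/lI/mem_nth.
    by apply: contrapT => nx; apply: nf; exists x.
  have [|g [Ig lg] gmin] := @min_mlead _ _ [set f | I f /\ ~ span_seq l f] f.
    by split.
  by exists g => _; split=> // h Ih lh; apply: gmin.
pose L i := iter i (fun l => rcons l (F l)) [::].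
have LI i : forall x, x \in L i -> I x.
  elim: i => [|i IH] x //=; rewrite mem_rcons inE => /predU1P[->|/IH//].
  by have [] := FP _ IH.
have FL i j : (i < j)%N -> F (L i) \in L j.
  elim: j => // j IH; rewrite ltnS leq_eqVlt /= mem_rcons inE => /predU1P[->|/IH->].
    by rewrite eqxx.
  by rewrite orbT.
have [i [j [ij le_ij]]] := dickson (fun i => mlead (F (L i))).
have [Ii spi _] := FP _ (LI i); have [Ij spj jmin] := FP _ (LI j).
set f := F (L i) in Ii spi le_ij; set g := F (L j) in Ij spj jmin le_ij.
have nz l x : ~ span_seq l x -> x != 0.
  by move=> lx; apply/eqP => x0; apply: lx; rewrite x0;
     exact: ideal0 (span_seq_ideal _).
have f0 := nz _ _ _ spi; have g0 := nz _ _ _ spj.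
have lcf : mleadc f != 0 by rewrite mleadc_eq0.
pose c := mleadc g / mleadc f; pose m := (mlead g - mlead f)%MM.
have mE : (m + mlead f)%MM = mlead g by rewrite submK.
have lcg : mleadc g != 0 by rewrite mleadc_eq0.
have c0 : c != 0 by rewrite mulf_neq0 ?invr_eq0.
(* [h] cancels the leading term of [g] but stays outside the span of the earlier terms, against the
   minimality of [g]. *)
pose h := g - (c *: 'X_[m]) * f.
have Ih : I h by apply: idealB => //; apply: idealMl.
have sph : ~ span_seq (L j) h.
  move=> Lh; apply: spj; rewrite -[g](subrK (c *: 'X_[m] * f)).
  apply: idealD Lh _; first exact: span_seq_ideal.
  by apply: idealMl; [exact: span_seq_ideal|apply/mem_span_seq/FL].
have h0 := nz _ _ _ sph.
case/negP: (jmin _ Ih sph); rewrite lt_neqAle; apply/andP; split; last first.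
  apply: le_trans (mleadB_le _ _) _; rewrite leUx lexx /=.
  rewrite mleadM ?mleadZ ?mleadXm ?mE // scaler_eq0 (negPf c0).
  by rewrite -msize_poly_eq0 msizeX.
apply: contraNneq h0 => hg; rewrite -mleadc_eq0 hg mcoeffB subr_eq0 eq_sym.
by rewrite -{1}mE -scalerAl mcoeffZ ['X_[m] * f]mulrC mcoeffMX divfK.
Qed.

(** * Symbolic powers *)

Lemma idealM_le (A : comNzRingType) (I J L : set A) :
  I `<=` J -> idealM I L `<=` idealM J L.
Proof.
by move=> IJ x [n [a [b [Ia Lb ->]]]]; exists n, a, b; split=> // i; apply: IJ.
Qed.

Lemma symbolic_power_le (A : idomainType) (I : set A) a b :
  (a <= b)%N -> symbolic_power I b `<=` symbolic_power I a.
Proof.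
move=> ab f If P /If; apply: idealM_le => _ [x Ix <-].
by exists x => //; apply: idealX_le ab _ Ix.
Qed.

Lemma localization1 (A : idomainType) (P : set A) :
  Defs.prime_idealr P -> localization P 1.
Proof.
case=> [[_ P1 _] _]; exists 1, 1; rewrite rmorph1 divr1; split=> //.
by move=> P1'; case/negP: P1; rewrite inE.
Qed.

Lemma localizationM (A : idomainType) (P : set A) x y :
  Defs.prime_idealr P -> localization P x -> localization P y ->
  localization P (x * y).
Proof.
move=> [_ Ppr] [a [s [Ps ->]]] [b [t [Pt ->]]]; exists (a * b), (s * t); split.
  move=> Pst; have := Ppr s t; rewrite !inE => /(_ Pst) /orP[].
    by rewrite inE.
  by rewrite inE.
by rewrite !rmorphM /= invfM mulrACA.
Qed.

Lemma symbolic_power_exp (A : idomainType) (I : set A) a k f :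
  symbolic_power I a f -> symbolic_power I (a * k) (f ^+ k).
Proof.
move=> If P AP; have Ppr := AP.1; elim: k => [|k IH].
  rewrite muln0 expr0 rmorph1 -[X in idealM _ _ X]mulr1.
  by apply: idealM_unit; [exists 1; rewrite ?rmorph1|exact: localization1].
rewrite exprS rmorphM mulnS; apply: idealM_mul (If P AP) IH => [u v|x y].
  move=> [x Ix <-] [y Iy <-]; exists (x * y); first exact: idealX_mul.
  by rewrite rmorphM.
exact: localizationM.
Qed.

Lemma idealX_symbolic_power (A : idomainType) (I : set A) m :
  idealX I m `<=` symbolic_power I m.
Proof.
move=> f If P [Ppr _]; rewrite -[X in idealM _ _ X]mulr1.
by apply: idealM_unit; [exists f|exact: localization1].
Qed.

Lemma symbolic_power_sub n (K : fieldType) (I : set {mpoly K[n]}) s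
    (g : 'I_s -> {mpoly K[n]}) m0 r0 m r :
  homogeneous_ideal I -> generated_by I g -> (0 < m)%N ->
  (m0 * (r + s) < r0 * m)%N ->
  (forall T0, exists2 T, (T0 <= T)%N &
    symbolic_power I (m0 * T) `<=` idealX I (r0 * T)) ->
  symbolic_power I m `<=` idealX I r.
Proof.
move=> hI Ig m_gt0 lt_m inf f If.
(* This bound on [T] pays for rounding [k] up: [m * k * (r + s)] is at most
   [(m0 * (r + s) + 1) * T], hence at most [m * r0 * T]. *)
have [T T_ge sub] := inf (m * (r + s))%N.
pose k := ((m0 * T) %/ m).+1.
have k_ge : (m0 * T <= m * k)%N by rewrite [(m * _)%N]mulnC; apply/ltnW/ltn_ceil.
have k_le : (m * k <= m0 * T + m)%N.
  by rewrite mulnS addnC leq_add2r [(m * _)%N]mulnC leq_trunc_div.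
apply: (briancon_skoda hI Ig (_ : 0 < k)%N) => //.
apply: (@idealX_le _ _ _ (r0 * T)); last first.
  by apply: sub; apply: symbolic_power_le k_ge _ _; apply: symbolic_power_exp.
rewrite -(leq_pmul2l m_gt0) mulnA (leq_trans (leq_mul k_le (leqnn _))) //.
rewrite mulnDl (leq_trans (leq_add (leqnn _) T_ge)) //.
by rewrite mulnAC -mulSnr mulnA [(m * r0)%N]mulnC leq_mul2r lt_m orbT.
Qed.

(** Without constant terms in [I], each factor from [I] raises the order of vanishing at the origin
    by at least one. *)
Lemma idealX_mdeg_ge n (K : fieldType) (I : set {mpoly K[n]}) N f m :
  (forall p, I p -> p@_0%MM = 0) -> idealX I N f -> m \in msupp f ->
  (N <= mdeg m)%N.
Proof.
move=> I0 If; rewrite leqNgt -[_ \in _]negbK -mcoeff_eq0 => nz.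
apply: contra nz => mN; apply/eqP; elim: N f If m mN => // N IH f.
move=> [w [a [b [Ia Ib ->]]]] m mN; rewrite raddf_sum big1 //= => i _.
rewrite mcoeffM big1 // => -[[m1 _] [m2 _]] /= /eqP mE.
have [m10|m10] := eqVneq m1 0%MM; first by rewrite m10 I0 // mul0r.
rewrite [X in _ * X]IH ?mulr0 //; first exact: Ib.
have := congr1 mdeg mE; rewrite mdegD => dm.
rewrite -ltnS (leq_trans _ mN) // ltnS dm -[X in (X < _)%N]add0n ltn_add2r.
by rewrite lt0n mdeg_eq0.
Qed.

(** * Resurgence *)

Lemma asymptotic_resurgence_le_rho_lim (R : realType) (A : idomainType)
    (I : set A) :
  (asymptotic_resurgence R I <= rho_lim R I)%E.
Proof.
apply: ge_ereal_sup => _ [m [r [m_gt0 r_gt0 [n0 _ n0P] ->]]].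
(* The upper limit is an infimum, over sets [V] containing all large indices, of suprema of [rho] on
   [V]; one index [n1] in [V] suffices. *)
apply: le_ereal_inf_tmp => _ [V [n1 _ n1V] <-].
apply: le_ereal_sup_tmp; exists (rho R I n1).
  by exists n1 => //; apply: n1V => /=.
apply: ereal_sup_ubound; pose t := (maxn n0 n1).+1.
have t_ge k : (0 < k)%N -> (n1 <= k * t)%N.
  move=> k_gt0; rewrite (leq_trans _ (leq_pmull _ k_gt0)) //.
  by rewrite ltnW // ltnS leq_maxr.
exists (m * t)%N, (r * t)%N; split; rewrite ?muln_gt0 ?m_gt0 ?r_gt0 ?t_ge //.
  by apply: n0P; rewrite /= ltnW // ltnS leq_maxl.
by rewrite !natrM -mulf_div divff ?mulr1 // pnatr_eq0.
Qed.

(** Excludes the value [-oo] of an empty supremum and gives the positivity that [ratio_between]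
    requires. *)
Lemma asymptotic_resurgence_gt0 (R : realType) n (K : fieldType)
    (I : set {mpoly K[n]}) :
  proper_idealr I -> homogeneous_ideal I -> I <> [set 0] ->
  (0 < asymptotic_resurgence R I)%E.
Proof.
move=> Ip hI In0.
(* By homogeneity, a nonzero constant term would put 1 in [I]. *)
have const0 p : I p -> p@_0%MM = 0.
  move=> Ip'; apply/eqP/negPn/negP => p0.
  have [_ I1 _] := Ip; case/negP: I1; rewrite inE.
  have -> : 1 = (p@_0%MM)^-1%:MP * pihomog mdeg 0 p.
    apply/mpolyP => m; rewrite mcoeffCM mcoeff_pihomog mcoeff1 mdeg_eq0.
    by case: eqP => [->|_]; rewrite ?mulr0 // mulVf.
  by apply: idealMl (proper_ideal Ip) _; apply: hI.
have [f If f0] : exists2 f, I f & f != 0.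
  apply: contrapT => nf; apply: In0; apply/seteqP; split=> [f If|f ->] /=.
    by apply/eqP/negPn/negP => f0; apply: nf; exists f.
  exact: ideal0 (proper_ideal Ip).
(* [d] is one more than the degree of [f], so for positive [t] the degree of [f ^+ t] is below
   [d * t], too small for the power [d * t] of [I]. *)
pose d := msize f; have d_gt0 : (0 < d)%N by rewrite lt0n msize_poly_eq0.
apply: (@lt_le_trans _ _ (1%:R / d%:R)%:E).
  by rewrite lte_fin divr_gt0 // ltr0n.
apply: ereal_sup_ubound; exists 1%N, d; split=> //; exists 1%N => // t /= t_gt0 sub.
have ft : idealX I (1 * t) (f ^+ t) by apply/idealX_exp/idealX1.
have := idealX_mdeg_ge const0 (sub _ (idealX_symbolic_power ft)) (mlead_supp _).
rewrite expf_neq0 // mleadX // mdegMn leq_pmul2r // => /(_ isT).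
by rewrite /d -mlead_deg // ltnn.
Qed.

Lemma rho_lim_le (R : realType) n (K : fieldType) (I : set {mpoly K[n]})
    m0 r0 (z : R) :
  proper_idealr I -> homogeneous_ideal I ->
  (forall T0, exists2 T, (T0 <= T)%N &
    symbolic_power I (m0 * T) `<=` idealX I (r0 * T)) ->
  m0%:R < z * r0%:R ->
  (rho_lim R I <= z%:E)%E.
Proof.
move=> Ip hI inf m0z.
have [s [g Ig]] := hilbert_basis (proper_ideal Ip).
pose e := z * r0%:R - m0%:R; have e_gt0 : 0 < e by rewrite subr_gt0.
(* For [r >= t0] and [z * r < m] this gives [m0 * (r + s) < m0 * r + e * r = z * r0 * r <= r0 *
   m]. *)
pose t0 := Num.bound (m0%:R * s%:R / e).
have t0P : m0%:R * s%:R < t0%:R * e.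
  by rewrite -ltr_pdivrMr // archi_boundP // divr_ge0 ?mulr_ge0 // ltW.
apply: ge_ereal_inf; exists (ereal_sup
  [set rho R I k | k in [set k | (t0 <= k)%N]]).
  by exists [set k | (t0 <= k)%N] => //; exists t0.
apply: ge_ereal_sup => _ [k kt0 <-].
apply: ge_ereal_sup => _ [m [r [[m_gt0 r_gt0] _ kr nsub ->]]].
rewrite lee_fin leNgt; apply/negP; rewrite ltr_pdivlMr ?ltr0n // => zr.
apply: nsub; apply: symbolic_power_sub hI Ig m_gt0 _ inf.
rewrite -(ltr_nat R) !natrM natrD.
have tr : t0%:R <= r%:R :> R by rewrite ler_nat (leq_trans kt0).
have r0_ge : 0 <= r0%:R :> R by [].
have te : t0%:R * e <= r%:R * e by rewrite ler_wpM2r // ltW.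
have zr' : z * r%:R * r0%:R <= m%:R * r0%:R by rewrite ler_wpM2r // ltW.
rewrite /e in te t0P; nra.
Qed.

Lemma ratio_between (R : realType) (a z : R) : 0 < a -> a < z ->
  exists m r : nat, [/\ (0 < m)%N, (0 < r)%N, a * r%:R < m%:R & m%:R < z * r%:R].
Proof.
move=> a_gt0 az; pose r := (Num.bound (z - a)^-1).+1.
have za : 0 < z - a by rewrite subr_gt0.
have rP : 1 < r%:R * (z - a).
  rewrite -ltr_pdivrMr // div1r (lt_le_trans (archi_boundP _)) ?invr_ge0 ?ltW //.
  by rewrite ltr_nat.
have ar : 0 <= a * r%:R by rewrite mulr_ge0 // ltW.
have /andP[lo hi] := truncn_itv ar.
exists (Num.truncn (a * r%:R)).+1, r; split=> //.
by rewrite -natr1; lra.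
Qed.

Theorem theorem2p2 (R : realType) (K : fieldType) (N : nat)
    (N_ge1 : (1 <= N)%N)
    (I : set {mpoly K[N.+1]})
    (I_proper : proper_idealr I)
    (I_homog : homogeneous_ideal I)
    (I_neq0 : I <> [set 0]) :
  asymptotic_resurgence R I = rho_lim R I.
Proof.
apply/eqP; rewrite eq_le asymptotic_resurgence_le_rho_lim /=.
rewrite leNgt; apply/negP => lt.
have [a aE] : exists a : R, asymptotic_resurgence R I = a%:E.
  have := asymptotic_resurgence_gt0 R I_proper I_homog I_neq0.
  move: lt; case: (asymptotic_resurgence R I) => [a| |] //; first by exists a.
  by rewrite ltNge leey.
have a_gt0 : 0 < a.
  by rewrite -lte_fin -aE asymptotic_resurgence_gt0.
have [z az zl] : exists2 z : R, a < z & (z%:E < rho_lim R I)%E.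
  move: lt; rewrite aE; case: (rho_lim R I) => [l| |] //; rewrite ?lte_fin => al.
    by exists ((a + l) / 2); rewrite ?lte_fin; lra.
  by exists (a + 1); rewrite ?ltry // ltrDl.
have [m [r [m_gt0 r_gt0 am mz]]] := ratio_between a_gt0 az.
move: zl; rewrite ltNge => /negP; apply.
apply: rho_lim_le I_proper I_homog _ mz => T0.
apply: contrapT => nT.
have : ((m%:R / r%:R)%:E <= asymptotic_resurgence R I)%E.
  apply: ereal_sup_ubound; exists m, r; split=> //; exists T0 => // t /= T0t sub.
  by apply: nT; exists t.
by rewrite aE lee_fin ler_pdivrMr ?ltr0n // leNgt am.
Qed.
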